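(* For each $c>0$ there exists $C>0$ such that the following holds. Let $G$ be a graph on vertex set $[n]$ with adjacency matrix $A_G$, Laplacian $\mathcal{L}_G$, minimum degree $d_G$ and maximum degree $\Delta_G$; let $p\in(0,1)$ and let $G_p$ be the random subgraph of $G$ obtained by keeping each edge of $G$ independently with probability $p$, with adjacency matrix $A_{G_p}$ and Laplacian $\mathcal{L}_{G_p}$. Suppose $pd_G\geq C\ln n$. Then for all $n^{-c}\leq\delta\leq1/2$, $$\mathbb{P}\left(\|A_{G_p}-pA_G\|\leq4\sqrt{p\Delta_G\ln(n/\delta)}\right)\geq1-\delta$$ and $$\mathbb{P}\left(\|\mathcal{L}_{G_p}-\mathcal{L}_G\|\leq14\sqrt{\frac{\ln(4n/\delta)}{pd_G}}\right)\geq1-\delta.$$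
   Context: Graphs have vertex set $[n]$, loops allowed, no multiple edges. Adjacency matrix: $(i,j)$ entry $1$ if $ij$ is an edge, $0$ otherwise; degree of $i$ = number of $j$ with $ij$ an edge. Laplacian: $I_n-TAT$ with $T$ diagonal, $T_{ii}=\mathrm{deg}(i)^{-1/2}$ if $\mathrm{deg}(i)\neq0$ and $0$ otherwise. $\|\cdot\|$ is the spectral norm. *)

(* Defs.v *)
From mathcomp Require Import all_boot all_order all_algebra.
From mathcomp Require Import all_classical all_reals all_analysis.

Set Implicit Arguments.
Unset Strict Implicit.
Unset Printing Implicit Defensive.
Import Order.TTheory GRing.Theory Num.Theory.
Local Open Scope ring_scope.

(** A graph on ['I_n] is given by its edge set; the edge [ij] is [[set i; j]],
    so that a loop at [i] is the singleton [[set i]]. *)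
Definition is_graph (n : nat) (E : {set {set 'I_n}}) : bool :=
  [forall f in E, (1 <= #|f| <= 2)%N].

Definition degree (n : nat) (E : {set {set 'I_n}}) (i : 'I_n) : nat :=
  #|[set j : 'I_n | [set i; j] \in E]|.

(** All degrees are at most [n], so the default value [n] is harmless for
    [n > 0]. *)
Definition min_degree (n : nat) (E : {set {set 'I_n}}) : nat :=
  \big[minn/n]_(i < n) degree E i.

Definition max_degree (n : nat) (E : {set {set 'I_n}}) : nat :=
  (\max_(i < n) degree E i)%N.

Section Matrices.
Variables (R : realType) (n : nat).

Definition adjacency (E : {set {set 'I_n}}) : 'M[R]_n :=
  \matrix_(i, j) ([set i; j] \in E)%:R.

Definition inv_sqrt_degree (E : {set {set 'I_n}}) : 'M[R]_n :=
  diag_mx (\row_i (if degree E i == 0%N then 0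
                   else (Num.sqrt (degree E i)%:R)^-1)).

Definition laplacian (E : {set {set 'I_n}}) : 'M[R]_n :=
  1%:M - inv_sqrt_degree E *m adjacency E *m inv_sqrt_degree E.

Definition norm2 (v : 'cV[R]_n) : R := Num.sqrt (\sum_(i < n) v i ord0 ^+ 2).

Definition spectral_norm (M : 'M[R]_n) : R :=
  sup [set norm2 (M *m v) | v in [set v : 'cV[R]_n | norm2 v = 1]]%classic.

(** Probability that [G_p] has edge set [F], for [F] a subset of [E]. *)
Definition percolation_weight (E : {set {set 'I_n}}) (p : R)
    (F : {set {set 'I_n}}) : R :=
  \prod_(f in E) (if f \in F then p else 1 - p).

Definition percolation_prob (E : {set {set 'I_n}}) (p : R)
    (Q : pred {set {set 'I_n}}) : R :=
  \sum_(F : {set {set 'I_n}} | (F \subset E) && Q F) percolation_weight E p F.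

End Matrices.

Arguments adjacency R {n} E.
Arguments laplacian R {n} E.

(* Main.v *)
Require Import Defs.
From mathcomp Require Import all_boot all_order all_algebra.
From mathcomp Require Import all_classical all_reals all_analysis.
From mathcomp Require Import zify ring lra.
Import Order.TTheory GRing.Theory Num.Theory.
Local Open Scope ring_scope.

(** Both bounds come from one moment inequality for a centred sum
    [X = sum_e (1_{e in F} - p) B_e], where the [B_e] are symmetric with diagonal
    squares. Resampling the edge [e] gives
    [E tr X^(2k) = sum_e p (1 - p) E tr (B_e (X_1^(2k-1) - X_0^(2k-1)))],
    with [X_1 - X_0 = B_e]; the trace is at most
    [(2k-1)/2 * tr (B_e^2 (X_1^(2k-2) + X_0^(2k-2)))], because
    [j |-> tr (B_e X_1^j B_e X_0^(2k-2-j))] is midpoint convex by the AM-GM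
    inequality for the Frobenius product. Young's inequality on each diagonal entry
    then yields [E tr X^(2k) <= (2k-1)^k E (sum_i V_i^k)], where the [V_i] are
    weighted sums of independent variables, controlled by exponential moments.
    Markov's inequality with [k ~ ln (n / delta)] gives the tail bound.

    For the Laplacian the inequality is applied to the adjacency matrix normalised by
    the expected degrees and to the diagonal matrix of relative degree errors. If [N]
    is the normalised adjacency matrix of [G_p] and [K] the diagonal matrix of square
    roots of the degree ratios, then [KNK - N = (K - 1)NK + N(K - 1)], where
    [|N| <= 1] and [|K - 1|] is at most the largest relative degree error. *)

(** * Convex sequences *)

Section ConvexSequences.
Variable R : realFieldType.

(** For [y > 0] the hypothesis says that [h j / y ^+ j] is convex; clearing denominators also admits
    [y = 0]. The induction adds [y] times the bound at [k] to [k + 1] times the convexity at [k]. *)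
Lemma convex_seq_young (h : nat -> R) (y : R) (N : nat) : 0 <= y ->
  (forall j, (j.+1 < N)%N -> 2 * y * h j.+1 <= y ^+ 2 * h j + h j.+2) ->
  forall k, (k < N)%N -> k.+1%:R * y * h k <= y ^+ k.+1 * h 0%N + k%:R * h k.+1.
Proof.
move=> y0 hc; elim=> [|k IH] kN; first by rewrite expr1; lra.
have := hc k kN; have := ler_wpM2l y0 (IH (ltnW kN)).
move=> h1 h2; have k0 : 0 <= k.+1%:R :> R by rewrite ler0n.
have h3 := ler_wpM2l k0 h2.
rewrite [y ^+ k.+2]exprS -!natr1 in h1 h3 *; nra.
Qed.

(** [young] bounds [g k] by the chord from [0] to [k + 1]; inserting this into the chord from [0] to
    [k] gives the longer chord at every [i <= k]. *)
Lemma convex_seq_chord (g : nat -> R) (N : nat) :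
  (forall j, (j.+1 < N)%N -> 2 * g j.+1 <= g j + g j.+2) ->
  forall k i, (i <= k <= N)%N -> k%:R * g i <= (k - i)%:R * g 0%N + i%:R * g k.
Proof.
move=> hc.
have young k : (k < N)%N -> k.+1%:R * g k <= g 0%N + k%:R * g k.+1.
  move=> kN; have /(_ k kN) : forall k, (k < N)%N ->
      k.+1%:R * 1 * g k <= 1 ^+ k.+1 * g 0%N + k%:R * g k.+1.
    apply: convex_seq_young => // j jN.
    by rewrite expr1n mulr1 mul1r hc.
  by rewrite expr1n mulr1 mul1r.
elim=> [|k IH] i /andP[ik kN].
  by move: ik; rewrite leqn0 => /eqP ->; rewrite !mul0r addr0.
have [->|iNk] := eqVneq i k.+1; first by rewrite subnn mul0r add0r.
have {iNk}ik : (i <= k)%N by rewrite leq_eqVlt (negbTE iNk) in ik.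
have [k0|k0] := posnP k.
  by move: ik; rewrite k0 leqn0 => /eqP ->; rewrite subn0 mul0r addr0.
have := IH i; rewrite ik (ltnW kN) => /(_ isT) h1.
have h2 := young k kN.
have kp : 0 < k%:R :> R by rewrite ltr0n.
have k1p : 0 <= k.+1%:R :> R by rewrite ler0n.
have i0 : 0 <= i%:R :> R by rewrite ler0n.
rewrite -(ler_pM2l kp).
have := ler_wpM2l i0 h2; have := ler_wpM2l k1p h1.
rewrite !natrB ?(leqW ik)// -!natr1 => a b; nra.
Qed.

(** A discrete trapezoidal rule. The endpoints in the hypothesis are even because in
    [trace_exp_diff_le] the even terms are squared Frobenius norms. Even terms lie below the chord,
    and each odd term below the mean of its even neighbours. *)
Lemma sum_midpoint_convex (f : nat -> R) (N : nat) :
  (forall a b, (a <= N)%N -> (b <= N)%N ->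
     2 * f (a + b)%N <= f (a + a)%N + f (b + b)%N) ->
  \sum_(j < N.*2.+1) f j <= N.*2.+1%:R / 2 * (f 0%N + f N.*2).
Proof.
move=> hf.
have chord i : (i <= N)%N ->
    N%:R * f (i + i)%N <= (N - i)%:R * f 0%N + i%:R * f N.*2.
  move=> iN; rewrite -addnn.
  apply: (@convex_seq_chord (fun i => f (i + i)%N) N); last by rewrite iN leqnn.
  move=> j jN; have := hf j j.+2 (ltnW (ltnW jN)) jN.
  by rewrite addnS -addSn.
have even_odd (K : nat) : \sum_(j < K.*2.+1) f j =
    \sum_(j < K.+1) f (j + j)%N + \sum_(j < K) f (j + j.+1)%N.
  elim: K => [|K IH]; first by rewrite !big_ord_recr !big_ord0 /=; ring.
  rewrite doubleS big_ord_recr big_ord_recr /= IH.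
  rewrite [in RHS]big_ord_recr [X in _ = _ + X]big_ord_recr /=.
  have -> : (K.+1 + K.+1 = K.*2.+2)%N by rewrite addnn.
  have -> : (K + K.+1 = K.*2.+1)%N by rewrite addnS addnn.
  ring.
have odd_le : \sum_(j < N) f (j + j.+1)%N <=
    \sum_(j < N.+1) f (j + j)%N - (f 0%N + f N.*2) / 2.
  have : \sum_(j < N) f (j + j.+1)%N <=
      \sum_(j < N) (f (j + j)%N + f (j.+1 + j.+1)%N) / 2.
    by apply: ler_sum => j _; have := hf j j.+1 (ltnW (ltn_ord j)) (ltn_ord j); lra.
  move/le_trans; apply.
  rewrite -mulr_suml big_split /=.
  have e1 : \sum_(j < N.+1) f (j + j)%N = \sum_(j < N) f (j + j)%N + f N.*2.
    by rewrite big_ord_recr /= addnn.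
  have e2 : \sum_(j < N.+1) f (j + j)%N =
      f 0%N + \sum_(j < N) f (j.+1 + j.+1)%N by rewrite big_ord_recl.
  by lra.
have even_le : \sum_(j < N.+1) f (j + j)%N <= N.+1%:R / 2 * (f 0%N + f N.*2).
  have [->|N0] := posnP N; first by rewrite big_ord_recr big_ord0 /=; lra.
  have Np : 0 < N%:R :> R by rewrite ltr0n.
  (* Adding the chord bounds at [j] and [N - j] makes the right-hand side independent of [j]. *)
  have : N%:R * (\sum_(j < N.+1) f (j + j)%N + \sum_(j < N.+1) f (j + j)%N) <=
      N%:R * (N.+1%:R * (f 0%N + f N.*2)).
    rewrite {2}(reindex_inj rev_ord_inj) -big_split /= mulr_sumr.
    apply: (@le_trans _ _ (\sum_(j < N.+1) N%:R * (f 0%N + f N.*2))); last first.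
      by rewrite sumr_const card_ord -[leLHS]mulr_natl mulrCA.
    apply: ler_sum => j _; have jN : (j <= N)%N by rewrite -ltnS.
    rewrite subSS; have := chord j jN; have := chord (N - j)%N (leq_subr _ _).
    by rewrite subKn // natrB // => a b; nra.
  by rewrite ler_pM2l //; lra.
rewrite even_odd; have : N.*2.+1%:R = N.+1%:R + N.+1%:R - 1 :> R.
  by rewrite -addnn -!natr1 natrD; lra.
by move=> ->; lra.
Qed.

End ConvexSequences.

(** * Powers of symmetric matrices *)

Section SymmetricMatrices.
Variables (R : realType) (n : nat).
Implicit Types (A X Y P Q : 'M[R]_n) (u v : 'cV[R]_n).

Definition sqnorm v : R := \sum_i v i ord0 ^+ 2.

Lemma sqnorm_ge0 v : 0 <= sqnorm v.
Proof. by apply: sumr_ge0 => i _; exact: sqr_ge0. Qed.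

Lemma sqnorm_eq0 v : sqnorm v = 0 -> v = 0.
Proof.
move=> /eqP; rewrite psumr_eq0; last by move=> i _; exact: sqr_ge0.
move=> /allP v0; apply/matrixP => i j; rewrite ord1 mxE.
by have := v0 i (mem_index_enum _); rewrite sqrf_eq0 => /eqP.
Qed.

Lemma trmx_sym_exp A k : A^T = A -> (A ^+ k)^T = A ^+ k.
Proof.
move=> sA; elim: k => [|k IH]; first by rewrite expr0 trmx1.
by rewrite exprS -mulmxE trmx_mul IH sA mulmxE -exprSr exprS.
Qed.

Lemma mxtrace_tr_mul P Q : \tr (P^T *m Q) = \sum_i \sum_k P k i * Q k i.
Proof.
apply: eq_bigr => i _; rewrite mxE; apply: eq_bigr => k _; by rewrite mxE.
Qed.

Lemma frobenius_amgm P Q :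
  2 * \tr (P^T *m Q) <= \tr (P^T *m P) + \tr (Q^T *m Q).
Proof.
rewrite !mxtrace_tr_mul mulr_sumr -big_split; apply: ler_sum => i _ /=.
rewrite mulr_sumr -big_split; apply: ler_sum => k _ /=.
by have := sqr_ge0 (P k i - Q k i); nra.
Qed.

Lemma exp_diff_telescope X Y m :
  X ^+ m.+1 - Y ^+ m.+1 = \sum_(j < m.+1) X ^+ j * (X - Y) * Y ^+ (m - j).
Proof.
elim: m => [|m IH].
  by rewrite big_ord_recr big_ord0 /= !expr1 !expr0 mul1r mulr1 add0r.
rewrite big_ord_recl /= expr0 mul1r subn0.
under eq_bigr => i _ do rewrite /bump /= add1n subSS exprS -!mulrA.
rewrite -mulr_sumr; under eq_bigr => i _ do rewrite mulrA.
rewrite -IH mulrBr mulrBl -!exprS; set a := X ^+ _; set b := Y ^+ m.+2.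
by rewrite [RHS]addrC addrA addrNK.
Qed.

(** With [H = X - Y], the term [f (a + b)] of the telescoped trace is the Frobenius product of
    [X^a H Y^(N - a)] and [X^b H Y^(N - b)], so AM-GM makes [f] midpoint convex. Its end values
    [f 0] and [f N.*2] are the two traces on the right. *)
Lemma trace_exp_diff_le X Y N : X^T = X -> Y^T = Y ->
  \tr ((X - Y) * (X ^+ N.*2.+1 - Y ^+ N.*2.+1)) <=
  N.*2.+1%:R / 2 * (\tr ((X - Y) ^+ 2 * X ^+ N.*2) + \tr ((X - Y) ^+ 2 * Y ^+ N.*2)).
Proof.
move=> sX sY; set H := X - Y.
have sH : H^T = H by rewrite /H raddfB /= sX sY.
pose f j := \tr (H * X ^+ j * H * Y ^+ (N.*2 - j)).
have -> : \tr (H * (X ^+ N.*2.+1 - Y ^+ N.*2.+1)) = \sum_(j < N.*2.+1) f j.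
  rewrite exp_diff_telescope mulr_sumr raddf_sum; apply: eq_bigr => j _.
  by rewrite /f !mulrA.
have fE a b : (a <= N)%N -> (b <= N)%N ->
    f (a + b)%N = \tr ((X ^+ a * H * Y ^+ (N - a))^T *m (X ^+ b * H * Y ^+ (N - b))).
  move=> aN bN; rewrite -!mulmxE !trmx_mul sH !trmx_sym_exp // !mulmxE.
  rewrite -!mulrA -mulmxE mxtrace_mulC mulmxE /f exprD.
  have -> : (N.*2 - (a + b) = (N - b) + (N - a))%N.
    by lia.
  by rewrite exprD !mulrA.
apply: le_trans (sum_midpoint_convex _ _ _ _) _.
  by move=> a b aN bN; rewrite !fE //; exact: frobenius_amgm.
rewrite /f subn0 subnn !expr0 !mulr1 !expr2 addrC.
by rewrite -[in H * X ^+ _ * H]mulmxE mxtrace_mulC mulmxE !mulrA.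
Qed.

(** This is [|y A^j v - A^(j+2) v|^2 >= 0] expanded: by symmetry of [A] the cross term is the
    squared norm of [A^(j+1) v]. *)
Lemma sqnorm_exp_convex A v (y : R) j : A^T = A ->
  2 * y * sqnorm (A ^+ j.+1 *m v) <=
  y ^+ 2 * sqnorm (A ^+ j *m v) + sqnorm (A ^+ j.+2 *m v).
Proof.
move=> sA.
have gram P Q : \sum_i (P *m v) i ord0 * (Q *m v) i ord0 =
    (v^T *m (P^T *m Q) *m v) ord0 ord0.
  rewrite mulmxA -trmx_mul -mulmxA [RHS]mxE; apply: eq_bigr => i _.
  by rewrite [in RHS]mxE.
have dotE : \sum_i (A ^+ j *m v) i ord0 * (A ^+ j.+2 *m v) i ord0 =
    sqnorm (A ^+ j.+1 *m v).
  rewrite /sqnorm; under [RHS]eq_bigr => i _ do rewrite expr2.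
  by rewrite !gram !trmx_sym_exp // !mulmxE -[A ^+ j * _]exprD
    -[A ^+ j.+1 * _]exprD addSnnS.
rewrite -subr_ge0 -dotE /sqnorm !mulr_sumr -big_split -sumrB /=.
apply: sumr_ge0 => i _.
by have := sqr_ge0 (y * (A ^+ j *m v) i ord0 - (A ^+ j.+2 *m v) i ord0); nra.
Qed.

(** Cauchy-Schwarz, from Lagrange's identity for the sum of the squares of
    [a i * b j - a j * b i]. *)
Lemma sum_mul_sqr_le (I : finType) (a b : I -> R) :
  (\sum_i a i * b i) ^+ 2 <= (\sum_i a i ^+ 2) * (\sum_i b i ^+ 2).
Proof.
have : 0 <= \sum_i \sum_j (a i * b j - a j * b i) ^+ 2.
  by apply: sumr_ge0 => i _; apply: sumr_ge0 => j _; exact: sqr_ge0.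
have -> : \sum_i \sum_j (a i * b j - a j * b i) ^+ 2 =
    2 * ((\sum_i a i ^+ 2) * (\sum_i b i ^+ 2) - (\sum_i a i * b i) ^+ 2).
  rewrite expr2 !big_distrlr /=.
  transitivity (\sum_i \sum_j (a i ^+ 2 * b j ^+ 2) +
     \sum_i \sum_j (a j ^+ 2 * b i ^+ 2) -
     2 * (\sum_i \sum_j (a i * b i * (a j * b j)))).
    rewrite mulr_sumr -big_split -sumrB; apply: eq_bigr => i _ /=.
    rewrite mulr_sumr -big_split -sumrB; apply: eq_bigr => j _ /=.
    by ring.
  by rewrite [X in _ + X - _]exchange_big /=; ring.
by rewrite pmulr_rge0 // subr_ge0.
Qed.

Lemma sqnorm_mulmx_frobenius A v :
  sqnorm (A *m v) <= \tr (A^T *m A) * sqnorm v.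
Proof.
rewrite mxtrace_tr_mul exchange_big mulr_suml; apply: ler_sum => i _.
rewrite mxE; apply: le_trans (sum_mul_sqr_le _ _ _) _.
by apply: ler_wpM2r; [exact: sqnorm_ge0|apply: ler_sum => j _; rewrite expr2].
Qed.

(** Convexity passes the growth factor [y] on from each power of [A] to the next, so
    [|A^k v|^2 >= y^k |v|^2]. This growth is at most the squared Frobenius norm of [A ^+ k], which
    is the trace on the right. *)
Lemma sqnorm_gt_trace_exp A v (y : R) k : A^T = A -> 0 <= y ->
  y * sqnorm v < sqnorm (A *m v) -> y ^+ k <= \tr (A ^+ k.*2).
Proof.
move=> sA y0 hv.
have step j : y * sqnorm (A ^+ j *m v) <= sqnorm (A ^+ j.+1 *m v).
  elim: j => [|j IH]; first by rewrite expr0 expr1 mul1mx ltW.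
  by have := sqnorm_exp_convex A v y j sA; have := ler_wpM2l y0 IH; nra.
have v0 : 0 < sqnorm v.
  rewrite lt_def sqnorm_ge0 andbT; apply: contraTneq hv => /sqnorm_eq0 ->.
  by rewrite mulmx0 /sqnorm big1 ?mulr0 ?ltxx // => i _; rewrite mxE expr0n.
have yk : y ^+ k * sqnorm v <= sqnorm (A ^+ k *m v).
  elim: (k) => [|j IH]; first by rewrite !expr0 mul1mx mul1r.
  by apply: le_trans (step j); rewrite exprS -mulrA ler_wpM2l.
rewrite -(ler_pM2r v0); apply: le_trans yk _.
apply: le_trans (sqnorm_mulmx_frobenius _ _) _.
by rewrite trmx_sym_exp // mulmxE -exprD addnn.
Qed.

Lemma diag_exp_even A k i : A^T = A ->
  (A ^+ k.*2) i i = sqnorm (A ^+ k *m delta_mx i ord0).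
Proof.
move=> sA; rewrite -colE -addnn exprD -mulmxE mxE /sqnorm.
apply: eq_bigr => j _; rewrite [in RHS]mxE expr2; congr (_ * _).
by rewrite -[in LHS](trmx_sym_exp A k sA) mxE.
Qed.

(** The scalar model is [(k + 1) y t^k <= y^(k+1) + k t^(k+1)]. The sequence [|A^j e_i|^2], equal to
    [1] at [j = 0], satisfies the hypothesis of [convex_seq_young], so eigenvalues do not enter. *)
Lemma diag_exp_young A k i (y : R) : A^T = A -> 0 <= y ->
  k.+1%:R * y * (A ^+ k.*2) i i <= y ^+ k.+1 + k%:R * (A ^+ k.+1.*2) i i.
Proof.
move=> sA y0; rewrite !diag_exp_even //.
have := @convex_seq_young R (fun j => sqnorm (A ^+ j *m delta_mx i ord0)) y k.+1 y0.
move=> /(_ (fun j _ => sqnorm_exp_convex _ _ _ _ sA) k (ltnSn k)).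
have := diag_exp_even A 0 i sA; rewrite /= !expr0 mxE eqxx => <-.
by rewrite mulr1.
Qed.

End SymmetricMatrices.

(** * Moments of centred Bernoulli sums of matrices *)

Section BernoulliSubsets.
Variables (R : realType) (I : finType) (E : {set I}) (p : R).
Implicit Types (F : {set I}) (f g : {set I} -> R).

(** [percolation_weight] over an arbitrary finite type; for sets of vertices the two agree by
    unfolding. *)
Definition bernoulli_weight F : R :=
  \prod_(e in E) (if e \in F then p else 1 - p).

Definition expect f : R := \sum_(F : {set I} | F \subset E) bernoulli_weight F * f F.

Lemma eq_expect f g : (forall F, f F = g F) -> expect f = expect g.
Proof. by move=> fg; apply: eq_bigr => F _; rewrite fg. Qed.

Lemma expectZ a f : expect (fun F => a * f F) = a * expect f.
Proof. by rewrite mulr_sumr; apply: eq_bigr => F _; rewrite mulrCA. Qed.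

Lemma expectD f g : expect (fun F => f F + g F) = expect f + expect g.
Proof. by rewrite -big_split; apply: eq_bigr => F _; rewrite mulrDr. Qed.

Lemma expect_sum (J : finType) (P : pred J) (f : J -> {set I} -> R) :
  expect (fun F => \sum_(j | P j) f j F) = \sum_(j | P j) expect (f j).
Proof.
by rewrite exchange_big; apply: eq_bigr => F _; rewrite mulr_sumr.
Qed.

(** Independence: distributing the product over [E] chooses the set [F] of those [e] that contribute
    [p * a e]. *)
Lemma expect_prod (a c : I -> R) :
  expect (fun F => \prod_(e in E) (if e \in F then a e else c e)) =
  \prod_(e in E) (p * a e + (1 - p) * c e).
Proof.
rewrite [RHS]big_mkcond /=.
(* An index outside [E] gets the summands [0] and [1], so only subsets of [E] survive the
   expansion. *)
transitivity (\prod_e ((if e \in E then p * a e else 0) +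
                       (if e \in E then (1 - p) * c e else 1))).
  rewrite bigA_distr /= /expect big_mkcond; apply: eq_bigr => F _.
  case: ifPn => [FE|/subsetPn[e eF eE]].
    rewrite -big_split big_mkcond; apply: eq_bigr => e _ /=.
    case: ifPn => eE; first by case: ifPn.
    by rewrite (contraNF (fintype.subsetP FE e) eE).
  by rewrite (bigD1 e) //= eF (negbTE eE) mul0r.
by apply: eq_bigr => e _; case: ifPn => // _; rewrite add0r.
Qed.

Lemma expect_cst a : expect (fun=> a) = a.
Proof.
rewrite -[RHS]mulr1 -[a in LHS]mulr1 expectZ; congr (_ * _).
transitivity (expect (fun F => \prod_(e in E) (if e \in F then 1 else 1))).
  by apply: eq_expect => F; rewrite big1 // => e _; rewrite if_same.
by rewrite expect_prod big1 // => e _; ring.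
Qed.

Lemma expect_split e f : e \in E ->
  expect f = \sum_(F : {set I} | (F \subset E) && (e \notin F))
    (\prod_(i in E | i != e) (if i \in F then p else 1 - p)) *
    (p * f (e |: F) + (1 - p) * f F).
Proof.
move=> eE; rewrite /expect (bigID (fun F : {set I} => e \in F)) /=.
rewrite (reindex_onto (fun F => e |: F) (fun F => F :\ e)) /=; last first.
  by move=> F /andP[_ eF]; rewrite finset.setD1K.
under eq_bigl => F.
  have -> : ((e |: F) \subset E) && (e \in e |: F) && ((e |: F) :\ e == F) =
            (F \subset E) && (e \notin F).
    rewrite finset.setU11 andbT finset.subUset finset.sub1set eE /=; congr (_ && _).
    apply/eqP/idP => [<-|eF]; first by rewrite finset.setD11.
    by rewrite finset.setU1K.
  over.
rewrite -big_split; apply: eq_bigr => F /andP[_ eF] /=.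
rewrite mulrDr /bernoulli_weight !(bigD1 e eE) /= finset.setU11 (negbTE eF).
have -> : \prod_(i in E | i != e) (if i \in e |: F then p else 1 - p) =
          \prod_(i in E | i != e) (if i \in F then p else 1 - p).
  by apply: eq_bigr => i /andP[_ ie]; rewrite finset.in_setU1 (negbTE ie).
by ring.
Qed.

(** Resampling [e] preserves the law: after [expect_split] both sides involve only [f (e |: F)] and
    [f F] with [e] outside [F], and [p + (1 - p) = 1]. *)
Lemma expect_resample e f : e \in E ->
  expect f = expect (fun F => p * f (e |: F) + (1 - p) * f (F :\ e)).
Proof.
move=> eE; rewrite !(expect_split _ _ eE); apply: eq_bigr => F /andP[_ eF].
have -> : e |: (e |: F) = e |: F by rewrite finset.setUA finset.setUid.
rewrite finset.setU1K //.
have -> : F :\ e = F by apply/finset.setDidPl; rewrite disjoint_sym finset.disjoints1.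
by congr (_ * _); ring.
Qed.

Hypothesis p01 : 0 < p < 1.

Lemma bernoulli_weight_ge0 F : 0 <= bernoulli_weight F.
Proof.
by apply: prodr_ge0 => e _; case: ifPn => _; case/andP: p01 => *; lra.
Qed.

Lemma le_expect f g : (forall F, f F <= g F) -> expect f <= expect g.
Proof.
by move=> fg; apply: ler_sum => F _; rewrite ler_wpM2l ?bernoulli_weight_ge0.
Qed.

(** * Trace moments of a centred sum *)

Section RandomMatrix.
Variables (n : nat) (B : I -> 'M[R]_n).
Hypothesis symB : forall e, (B e)^T = B e.
Hypothesis diagB : forall e i j, i != j -> (B e ^+ 2) i j = 0.

Definition centered_sum F : 'M[R]_n :=
  \sum_(e in E) ((e \in F)%:R - p) *: B e.

Lemma centered_sum_sym F : (centered_sum F)^T = centered_sum F.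
Proof.
rewrite raddf_sum; apply: eq_bigr => e _; apply/matrixP => i j.
by rewrite !mxE -[in RHS](symB e) mxE.
Qed.

Lemma centered_sum_diff e F : e \in E ->
  centered_sum (e |: F) - centered_sum (F :\ e) = B e.
Proof.
move=> eE; rewrite /centered_sum -sumrB (bigD1 e eE) /= finset.setU11 finset.setD11.
rewrite -scalerBl [X in _ + X]big1 ?addr0.
  by have -> : true%:R - p - (false%:R - p) = 1 :> R;
    [rewrite /=; ring|rewrite scale1r].
by move=> i /andP[_ ie]; rewrite finset.in_setU1 finset.in_setD1 (negbTE ie) /= subrr.
Qed.

(* The weight of [e] is the expected squared change of its indicator, given [F],
   when [e] is resampled. *)
Definition resampling_var F i : R :=
  (\sum_(e in E) (if e \in F then 1 - p else p) * (B e ^+ 2) i i) / 2.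

Lemma diag_sqr_ge0 e i : 0 <= (B e ^+ 2) i i.
Proof.
by rewrite expr2 -mulmxE -{1}symB mxE sumr_ge0 // => j _; rewrite mxE -expr2 sqr_ge0.
Qed.

Lemma resampling_var_ge0 F i : 0 <= resampling_var F i.
Proof.
apply: divr_ge0 => //; apply: sumr_ge0 => e _; apply: mulr_ge0.
  by case: ifPn => _; case/andP: p01 => *; lra.
exact: diag_sqr_ge0.
Qed.

(** As the square of [B e] is diagonal, only the diagonal of [M] enters, which reduces the later
    estimates to scalar ones at each index. *)
Lemma mxtrace_sqr_mul e (M : 'M[R]_n) :
  \tr (B e ^+ 2 * M) = \sum_i (B e ^+ 2) i i * M i i.
Proof.
apply: eq_bigr => i _; rewrite -mulmxE mxE (bigD1 i) //= big1 ?addr0 //.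
by move=> j ji; rewrite diagB ?mul0r // eq_sym.
Qed.

(** Resampling [e] on the left gives [p * (1 - p)] times the trace in [trace_exp_diff_le]. The
    weight on the right is chosen so that both outcomes of resampling also receive [p * (1 - p)]. *)
Lemma expect_edge_term_le m e : e \in E ->
  expect (fun F => ((e \in F)%:R - p) * \tr (B e * centered_sum F ^+ m.*2.+1)) <=
  m.*2.+1%:R / 2 *
    expect (fun F => (if e \in F then 1 - p else p) *
                     \tr (B e ^+ 2 * centered_sum F ^+ m.*2)).
Proof.
move=> eE; rewrite (expect_resample e) // [in leRHS](expect_resample e) //.
rewrite -expectZ; apply: le_expect => F; rewrite !finset.setU11 !finset.setD11 /=.
have := trace_exp_diff_le _ _ _ _ m (centered_sum_sym (e |: F))
                                   (centered_sum_sym (F :\ e)).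
rewrite centered_sum_diff // mulrBr raddfB /= => h.
have pq : 0 <= p * (1 - p) by case/andP: p01 => *; apply: mulr_ge0; lra.
by have := ler_wpM2l pq h; lra.
Qed.

(** The first factor of [X * X^(2m+1)] is expanded over [E]; the [1 / 2] of the edge terms goes into
    [resampling_var]. *)
Lemma expect_trace_recursion m :
  expect (fun F => \tr (centered_sum F ^+ m.+1.*2)) <=
  m.*2.+1%:R * expect (fun F => \sum_i
    resampling_var F i * (centered_sum F ^+ m.*2) i i).
Proof.
have -> : expect (fun F => \tr (centered_sum F ^+ m.+1.*2)) =
    \sum_(e in E) expect (fun F =>
       ((e \in F)%:R - p) * \tr (B e * centered_sum F ^+ m.*2.+1)).
  rewrite -expect_sum; apply: eq_expect => F; rewrite doubleS exprS.
  rewrite {1}/centered_sum mulr_suml raddf_sum; apply: eq_bigr => e _.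
  by rewrite /= -mulmxE -scalemxAl mxtraceZ.
apply: le_trans (ler_sum _ (fun e eE => expect_edge_term_le m e eE)) _.
rewrite -mulr_sumr -expect_sum -mulrA ler_wpM2l ?ler0n // -expectZ.
rewrite le_eqVlt; apply/orP; left; apply/eqP; apply: eq_expect => F.
under [in LHS]eq_bigr => e _ do rewrite mxtrace_sqr_mul mulr_sumr.
rewrite exchange_big /= mulr_sumr; apply: eq_bigr => i _.
rewrite /resampling_var mulrC [in RHS]mulrAC; congr (_ / _).
by rewrite mulr_suml; apply: eq_bigr => e _; rewrite mulrA.
Qed.

Lemma expect_trace_le m :
  expect (fun F => \tr (centered_sum F ^+ m.+1.*2)) <=
  m.*2.+1%:R ^+ m.+1 * expect (fun F => \sum_i resampling_var F i ^+ m.+1).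
Proof.
set M := expect _; set V := expect _.
(* Young's inequality at [y = m.*2.+1%:R * resampling_var F i] returns [m] of the [m.+1] copies of
   [M], so the recursion closes at a single order. *)
have : m.+1%:R * M <= m.*2.+1%:R ^+ m.+1 * V + m%:R * M.
  have m0 : 0 <= m.+1%:R :> R by rewrite ler0n.
  apply: le_trans (ler_wpM2l m0 (expect_trace_recursion m)) _.
  rewrite mulrA /M /V -!expectZ -expectD; apply: le_expect => F.
  rewrite !mulr_sumr -big_split; apply: ler_sum => i _ /=.
  have y0 : 0 <= m.*2.+1%:R * resampling_var F i.
    by rewrite mulr_ge0 ?ler0n ?resampling_var_ge0.
  have := diag_exp_young _ _ _ m i _ (centered_sum_sym F) y0.
  by rewrite exprMn !mulrA.
by rewrite -natr1 mulrDl mul1r addrC lerD2r.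
Qed.

End RandomMatrix.
End BernoulliSubsets.

(** * Tail bounds *)

Section ExponentialBounds.
Variable R : realType.

(** From [1 - x <= expR (- x)] comes [(1 - x) * expR x <= 1], while [1 - x] times the quadratic is
    [1 + x ^+ 2 * (1 - 2 * x)]. *)
Lemma expR_le_quad (x : R) : 0 <= x <= 1 / 2 -> expR x <= 1 + x + 2 * x ^+ 2.
Proof.
move=> /andP[x0 x2]; have := expR_ge1Dx (- x); rewrite expRN => h.
have ex := expR_gt0 x.
have : (1 - x) * expR x <= 1.
  by apply: le_trans (ler_wpM2r (ltW ex) h) _; rewrite mulVf // gt_eqF.
move=> h1; rewrite -(ler_pM2l (_ : 0 < 1 - x)); last by lra.
by apply: le_trans h1 _; nra.
Qed.

(** Used as [expR (1 / 4) <= 4 / e], which produces the constant [16] in [matrix_tail_bound]; the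
    proof takes the tenth power of [expR (1 / 8) <= 8 / 7]. *)
Lemma expR_5div4_le4 : expR (5 / 4) <= 4 :> R.
Proof.
have h : expR (1 / 8) <= 8 / 7 :> R.
  have := expR_ge1Dx (- (1 / 8) : R); rewrite expRN => h.
  rewrite -[leLHS]invrK -[leRHS]invrK lef_pV2 ?posrE ?invr_gt0 ?expR_gt0 //; lra.
have -> : 5 / 4 = 10%:R * (1 / 8) :> R by lra.
rewrite expRM_natl; apply: le_trans (_ : (8 / 7 : R) ^+ 10 <= _); last by lra.
by apply: lerXn2r => //; rewrite nnegrE; [exact: expR_ge0|lra].
Qed.

(** The exponential moment of one summand of [resampling_var]. The quadratic bounds average to
    [1 + 2 * p * (1 - p) * a * (1 + a)]. *)
Lemma bernoulli_expR_le (p a lam : R) :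
  0 < p < 1 -> 0 <= a -> a <= lam -> lam <= 1 / 2 ->
  p * expR ((1 - p) * a) + (1 - p) * expR (p * a) <= expR (2 * p * a * (1 + lam)).
Proof.
move=> /andP[p0 p1] a0 al l2; apply: le_trans (expR_ge1Dx _).
have h1 : expR ((1 - p) * a) <= 1 + (1 - p) * a + 2 * ((1 - p) * a) ^+ 2.
  by apply: expR_le_quad; apply/andP; split; nra.
have h2 : expR (p * a) <= 1 + p * a + 2 * (p * a) ^+ 2.
  by apply: expR_le_quad; apply/andP; split; nra.
have q0 : 0 <= 1 - p by lra.
have := ler_wpM2l (ltW p0) h1; have := ler_wpM2l q0 h2 => g1 g2.
apply: (@le_trans _ _ (1 + 2 * p * (1 - p) * a * (1 + a))); first by nra.
have pa : 0 <= p * a by rewrite mulr_ge0 // ltW.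
have paa : p * a * a <= p * a * lam by rewrite ler_wpM2l.
have : 0 <= p * (p * a) by rewrite mulr_ge0 // ltW.
have : 0 <= p * (p * a) * a by rewrite !mulr_ge0 // ltW.
by nra.
Qed.

End ExponentialBounds.

(** * Tail bound for a centred sum of matrices *)

Section Concentration.
Variables (R : realType) (I : finType) (E : {set I}) (p : R).
Hypothesis p01 : 0 < p < 1.
Variables (n : nat) (B : I -> 'M[R]_n).
Hypothesis symB : forall e, (B e)^T = B e.
Hypothesis diagB : forall e i j, i != j -> (B e ^+ 2) i j = 0.
Variables (s beta : R).
Hypothesis s_gt0 : 0 < s.
Hypothesis var_le : forall i, p * (\sum_(e in E) (B e ^+ 2) i i) <= s.
Hypothesis sqr_le : forall e i, e \in E -> (B e ^+ 2) i i <= beta.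

Notation X := (centered_sum R I E p n B).
Notation V := (resampling_var R I E p n B).

(** The inequality [u <= expR (u - 1)] at [u = V F i / s] replaces the [k]-th power by an
    exponential, whose expectation factorises over [E]. The bound on [k%:R * beta] keeps each
    exponent in the range of [bernoulli_expR_le]. *)
Lemma expect_resampling_var_exp k lam i : 0 <= lam -> lam <= 1 / 2 ->
  k%:R * beta <= lam * s ->
  expect R I E p (fun F => V F i ^+ k) <= (s * expR lam) ^+ k.
Proof.
move=> lam0 lam2 hk; have /andP[p0 p1] := p01.
pose th := k%:R / s; have th0 : 0 <= th by rewrite divr_ge0 ?ler0n // ltW.
(* The [1 / 2] comes from [resampling_var]; the factor [2] in [bernoulli_expR_le] undoes it. *)
pose a e := th * (B e ^+ 2) i i / 2.
have a0 e : 0 <= a e by rewrite divr_ge0 // mulr_ge0 // diag_sqr_ge0.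
have al e : e \in E -> a e <= lam.
  move=> eE; have h : th * (B e ^+ 2) i i <= lam.
    apply: le_trans (ler_wpM2l th0 (sqr_le e i eE)) _.
    by rewrite /th mulrAC ler_pdivrMr.
  by rewrite /a; lra.
have pw F : V F i ^+ k <= s ^+ k * expR (- k%:R) *
    \prod_(e in E) (if e \in F then expR ((1 - p) * a e) else expR (p * a e)).
  have V0 := resampling_var_ge0 R I E p p01 n B symB F i.
  have -> : \prod_(e in E) (if e \in F then expR ((1 - p) * a e) else expR (p * a e))
     = expR (th * V F i).
    rewrite /resampling_var mulr_suml mulr_sumr expR_sum; apply: eq_bigr => e _.
    by case: ifPn => _; congr expR; rewrite /a; ring.
  have -> : s ^+ k * expR (- k%:R) * expR (th * V F i) =
            (s * expR (V F i / s - 1)) ^+ k.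
    rewrite exprMn -expRM_natl -mulrA -expRD; congr (_ * expR _).
    by rewrite /th; ring.
  have W0 : 0 <= s * expR (V F i / s - 1) by rewrite mulr_ge0 ?expR_ge0 // ltW.
  apply: lerXn2r; rewrite ?nnegrE //.
  have := expR_ge1Dx (V F i / s - 1); rewrite addrC subrK => h.
  by rewrite mulrC -ler_pdivrMr.
apply: le_trans (le_expect _ _ _ _ p01 _ _ pw) _.
rewrite expectZ expect_prod exprMn -mulrA ler_wpM2l ?exprn_ge0 ?(ltW s_gt0) //.
have : \prod_(e in E) (p * expR ((1 - p) * a e) + (1 - p) * expR (p * a e)) <=
       expR (k%:R * (1 + lam)).
  apply: (@le_trans _ _ (\prod_(e in E) expR (2 * p * a e * (1 + lam)))).
    apply: ler_prod => e eE; apply/andP; split.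
      by rewrite addr_ge0 // mulr_ge0 ?expR_ge0 //; lra.
    by apply: bernoulli_expR_le => //; exact: al.
  rewrite -expR_sum ler_expR -mulr_suml ler_wpM2r //; first by lra.
  have -> : \sum_(e in E) 2 * p * a e = th * (p * \sum_(e in E) (B e ^+ 2) i i).
    by rewrite !mulr_sumr; apply: eq_bigr => e _; rewrite /a; lra.
  apply: le_trans (ler_wpM2l th0 (var_le i)) _.
  by rewrite /th mulfVK // gt_eqF.
move=> /(ler_wpM2l (expR_ge0 (- k%:R))) /le_trans; apply.
by rewrite -expRD -expRM_natl ler_expR; lra.
Qed.

(** Markov's inequality for the trace of the power [2 * m.+1]. The ratio of moment bound to
    threshold is [n] times the [m.+1]-th power of [(2m + 1) s e^(1/4) / (16 s L)], and
    [2m + 1 <= 4 L] with [e^(1/4) <= 4 / e] makes this base at most [1 / e]. *)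
Lemma matrix_tail_bound (L : R) (Q : pred {set I}) : 1 <= L -> 8 * L * beta <= s ->
  (forall F, ~~ Q F -> exists v, 16 * s * L * sqnorm R n v < sqnorm R n (X F *m v)) ->
  expect R I E p (fun F => (~~ Q F)%:R) <= n%:R * expR (- L).
Proof.
move=> L1 hL hQ.
have L0 : 0 < L by lra.
(* Thus [m.+1] exceeds [L], which gives the decay [expR (- L)], and is at most [2 * L] because
   [1 <= L]. *)
pose m := Num.truncn L.
have /andP[mL Lm] : m%:R <= L < m.+1%:R by apply: truncn_itv; lra.
pose y := 16 * s * L; have y0 : 0 < y by rewrite !mulr_gt0.
have tr0 F : 0 <= \tr (X F ^+ m.+1.*2).
  apply: sumr_ge0 => i _; rewrite diag_exp_even; first exact: sqnorm_ge0.
  exact: centered_sum_sym.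
have pw F : (~~ Q F)%:R <= (y ^+ m.+1)^-1 * \tr (X F ^+ m.+1.*2).
  have [_|nQ] := boolP (Q F); first by rewrite mulr_ge0 // invr_ge0 exprn_ge0 // ltW.
  have [v hv] := hQ F nQ.
  rewrite mulrC ler_pdivlMr ?exprn_gt0 // mul1r.
  by apply: sqnorm_gt_trace_exp hv; [exact: centered_sum_sym|exact: ltW].
apply: le_trans (le_expect _ _ _ _ p01 _ _ pw) _.
rewrite expectZ mulrC ler_pdivrMr ?exprn_gt0 //.
apply: le_trans (expect_trace_le _ _ _ _ p01 _ _ symB diagB m) _.
rewrite expect_sum.
(* The hypothesis [8 * L * beta <= s] is what allows [lam = 1 / 4]. *)
have hk : m.+1%:R * beta <= 1 / 4 * s.
  have [b0|b0] := leP 0 beta; last first.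
    apply: (@le_trans _ _ 0); last by rewrite mulr_ge0 ?(ltW s_gt0).
    by rewrite mulr_ge0_le0 ?ler0n // ltW.
  have : m.+1%:R * beta <= 2 * L * beta by rewrite ler_wpM2r // -natr1; lra.
  by lra.
apply: (@le_trans _ _ (m.*2.+1%:R ^+ m.+1 *
          \sum_(i < n) (s * expR (1 / 4)) ^+ m.+1)).
  rewrite ler_wpM2l ?exprn_ge0 ?ler0n //; apply: ler_sum => i _.
  by apply: expect_resampling_var_exp => //; lra.
rewrite sumr_const card_ord -[X in _ * X <= _]mulr_natl mulrCA -exprMn -mulrA.
rewrite ler_wpM2l ?ler0n //.
apply: (@le_trans _ _ (expR (- m.+1%:R) * y ^+ m.+1)); last first.
  by rewrite ler_wpM2r ?exprn_ge0 ?(ltW y0) // ler_expR lerN2 ltW.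
have -> : expR (- m.+1%:R) = expR (-1) ^+ m.+1 :> R.
  by rewrite -expRM_natl mulrN1.
rewrite -exprMn; apply: lerXn2r;
  rewrite ?nnegrE ?mulr_ge0 ?expR_ge0 ?ler0n ?(ltW L0) ?(ltW s_gt0) //.
have e4 : expR (1 / 4) <= 4 * expR (-1) :> R.
  have := expR_5div4_le4 R.
  have -> : 5 / 4 = 1 / 4 + 1 :> R by lra.
  by rewrite expRD expRN -ler_pdivlMr ?expR_gt0.
have m4 : m.*2.+1%:R <= 4 * L.
  by rewrite -natr1 -addnn natrD; lra.
have -> : expR (-1) * y = 4 * L * (s * (4 * expR (-1))) by rewrite /y; ring.
apply: ler_pM => //.
  by rewrite mulr_ge0 ?expR_ge0 // ltW.
by rewrite ler_pM2l.
Qed.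

End Concentration.

(** * Operator bounds and edge matrices *)

Section OperatorBounds.
Variables (R : realType) (n : nat).
Implicit Types (M N : 'M[R]_n) (u v : 'cV[R]_n).

(** An operator bound without the supremum, so that sums and products are estimated vector by
    vector. *)
Definition op_le M (t : R) : Prop :=
  forall v, norm2 (M *m v) <= t * norm2 v.

Lemma norm2_ge0 v : 0 <= norm2 v.
Proof. exact: sqrtr_ge0. Qed.

Lemma sqr_norm2 v : norm2 v ^+ 2 = sqnorm R n v.
Proof. by rewrite sqr_sqrtr // sqnorm_ge0. Qed.

Lemma norm2_le v (t : R) : 0 <= t -> sqnorm R n v <= t ^+ 2 -> norm2 v <= t.
Proof.
move=> t0 h; rewrite -(ler_pXn2r (_ : 0 < 2)%N) ?nnegrE ?norm2_ge0 //.
by rewrite sqr_norm2.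
Qed.

Lemma norm2_triangle u v : norm2 (u + v) <= norm2 u + norm2 v.
Proof.
have nu := norm2_ge0 u; have nv := norm2_ge0 v.
apply: norm2_le; first by rewrite addr_ge0.
have cs : \sum_i u i ord0 * v i ord0 <= norm2 u * norm2 v.
  apply: le_trans (ler_norm _) _.
  rewrite -(ler_pXn2r (_ : 0 < 2)%N) ?nnegrE ?mulr_ge0 //.
  rewrite real_normK ?num_real // exprMn !sqr_norm2.
  exact: sum_mul_sqr_le.
have -> : sqnorm R n (u + v) =
    sqnorm R n u + 2 * (\sum_i u i ord0 * v i ord0) + sqnorm R n v.
  rewrite mulr_sumr -!big_split; apply: eq_bigr => i _ /=.
  by rewrite mxE; ring.
by rewrite sqrrD !sqr_norm2; lra.
Qed.

Lemma norm2_opp v : norm2 (- v) = norm2 v.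
Proof. by congr Num.sqrt; apply: eq_bigr => i _; rewrite mxE sqrrN. Qed.

Lemma op_leN M t : op_le M t -> op_le (- M) t.
Proof. by move=> h v; rewrite mulNmx norm2_opp. Qed.

Lemma op_leD M N a b : op_le M a -> op_le N b -> op_le (M + N) (a + b).
Proof.
move=> hM hN v; rewrite mulmxDl mulrDl.
by apply: le_trans (norm2_triangle _ _) _; rewrite lerD.
Qed.

Lemma op_leM M N a b : 0 <= a -> op_le M a -> op_le N b -> op_le (M *m N) (a * b).
Proof.
move=> a0 hM hN v; rewrite -mulmxA -mulrA.
by apply: le_trans (hM _) _; rewrite ler_wpM2l.
Qed.

Lemma op_le_diag (d : 'I_n -> R) t : 0 <= t -> (forall i, `|d i| <= t) ->
  op_le (diag_mx (\row_i d i)) t.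
Proof.
move=> t0 hd v; apply: norm2_le; first by rewrite mulr_ge0 ?norm2_ge0.
rewrite exprMn sqr_norm2 mulr_sumr; apply: ler_sum => i _.
rewrite mul_diag_mx !mxE exprMn ler_wpM2r ?sqr_ge0 // -real_normK ?num_real //.
by apply: lerXn2r; rewrite ?nnegrE.
Qed.

(** Testing on a basis vector turns the tail bound for the diagonal matrix of degree errors into a
    bound at every vertex. *)
Lemma op_le_diag_entry (d : 'I_n -> R) t i :
  op_le (diag_mx (\row_i d i)) t -> `|d i| <= t.
Proof.
have dE (c : R) (v : 'cV[R]_n) : v = c *: delta_mx i ord0 -> norm2 v = `|c|.
  move=> ->; rewrite /norm2 (bigD1 i) //= big1 => [|j ji]; last first.
    by rewrite !mxE (negbTE ji) mulr0 expr0n.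
  by rewrite !mxE !eqxx mulr1 addr0 sqrtr_sqr.
move=> /(_ (delta_mx i ord0)); rewrite (dE (d i)); last first.
  rewrite mul_diag_mx; apply/matrixP => j k; rewrite !mxE.
  by case: eqVneq => [->|]; rewrite ?mulr0.
by rewrite (dE 1) ?scale1r // normr1 mulr1.
Qed.

Lemma not_op_le M t : 0 <= t -> ~ op_le M t ->
  exists v, t ^+ 2 * sqnorm R n v < sqnorm R n (M *m v).
Proof.
move=> t0 h; apply: contrapT => hv; apply: h => v.
apply: norm2_le; first by rewrite mulr_ge0 ?norm2_ge0.
rewrite exprMn sqr_norm2 leNgt; apply/negP => hlt; apply: hv; by exists v.
Qed.

Lemma spectral_norm_le M t : (0 < n)%N -> op_le M t -> spectral_norm M <= t.
Proof.
move=> n0 h; apply: ge_sup.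
  (* [ge_sup] asks for a nonempty set; a basis vector, available since [0 < n], provides a
     member. *)
  pose v : 'cV[R]_n := delta_mx (Ordinal n0) ord0.
  exists (norm2 (M *m v)); exists v => //=.
  rewrite /norm2 (bigD1 (Ordinal n0)) //= big1 => [|j ji]; last first.
    by rewrite !mxE (negbTE ji) expr0n.
  by rewrite !mxE !eqxx expr1n addr0 sqrtr1.
by move=> x [v /= v1 <-]; have := h v; rewrite v1 mulr1.
Qed.

End OperatorBounds.

(** * Matrices carried by a single edge *)

Section EdgeMatrices.
Variables (R : realType) (n : nat).
Implicit Types (E F : {set {set 'I_n}}) (e : {set 'I_n}) (w : 'I_n -> R).

(** Cancels a common endpoint, also for loops, where the pair collapses to a singleton. *)
Lemma eq_set2_middle (i j l : 'I_n) : ([set i; j] = [set j; l])%SET -> i = l.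
Proof.
move=> h; have : i \in [set j; l]%SET by rewrite -h finset.set21.
rewrite finset.in_set2 => /orP[/eqP ij|/eqP //].
have : l \in [set i; j]%SET by rewrite h finset.set22.
by rewrite finset.in_set2 ij orbb => /eqP.
Qed.

(** The indicator that [e] is an edge at [i], a loop counting once: at most one term is nonzero. The
    sum over the other endpoint matches the diagonal of the squared [edge_mx]. *)
Definition incidence e (i : 'I_n) : R := \sum_j ([set i; j]%SET == e)%:R.

Lemma incidence_itv e i : 0 <= incidence e i <= 1.
Proof.
apply/andP; split; first by apply: sumr_ge0.
rewrite /incidence; have [/existsP[j /eqP je]|] := boolP [exists j, [set i; j]%SET == e].
  rewrite (bigD1 j) //= big1 ?addr0; first by case: (_ == _).
  move=> l lj; rewrite -je; case: eqP => // h; case/eqP: lj.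
  by apply: (@eq_set2_middle _ i); rewrite finset.setUC h.
by move=> /existsPn h; rewrite big1 // => j _; rewrite (negbTE (h j)).
Qed.

Lemma sum_edge_indicator E (c : {set 'I_n} -> R) (g : {set 'I_n}) :
  \sum_(e in E) c e * (g == e)%:R = c g * (g \in E)%:R.
Proof.
have [gE|gE] := boolP (g \in E).
  rewrite (bigD1 g) //= eqxx big1 ?addr0 // => e /andP[_ eg].
  by rewrite eq_sym (negbTE eg) mulr0.
rewrite mulr0 big1 // => e eE; case: eqP => [ge|]; last by rewrite mulr0.
by rewrite ge eE in gE.
Qed.

Lemma degreeE E i : (degree E i)%:R = \sum_j ([set i; j]%SET \in E)%:R :> R.
Proof.
rewrite /degree -sum1_card natr_sum big_mkcond; apply: eq_bigr => j _.
by rewrite finset.inE; case: (_ \in E).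
Qed.

Lemma sum_incidence E i : \sum_(e in E) incidence e i = (degree E i)%:R.
Proof.
rewrite /incidence exchange_big degreeE; apply: eq_bigr => j _ /=.
have := sum_edge_indicator E (fun=> 1) [set i; j]%SET; rewrite mul1r => <-.
by apply: eq_bigr => e _; rewrite mul1r.
Qed.

(** The weights are [1] for the adjacency matrix and inverse square roots of expected degrees for
    the Laplacian. *)
Definition edge_mx w e : 'M[R]_n :=
  \matrix_(i, j) (w i * w j * ([set i; j]%SET == e)%:R).

Lemma edge_mx_sym w e : (edge_mx w e)^T = edge_mx w e.
Proof. by apply/matrixP => i j; rewrite !mxE finset.setUC [w j * _]mulrC. Qed.

(** A walk of two steps along the single edge [e] returns to its start, even if [e] is a loop. *)
Lemma edge_mx_sqr_offdiag w e i j : i != j -> (edge_mx w e ^+ 2) i j = 0.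
Proof.
move=> ij; rewrite expr2 -mulmxE mxE big1 // => k _; rewrite !mxE.
case: eqP => [ike|]; last by rewrite mulr0 mul0r.
case: eqP => [kje|]; last by rewrite !mulr0.
by case/eqP: ij; apply: (@eq_set2_middle _ k); rewrite ike kje.
Qed.

Lemma edge_mx_sqr_diag w e i : (edge_mx w e ^+ 2) i i =
  \sum_j w i ^+ 2 * w j ^+ 2 * ([set i; j]%SET == e)%:R.
Proof.
rewrite expr2 -mulmxE mxE; apply: eq_bigr => j _; rewrite !mxE.
by rewrite [[set j; i]%SET]finset.setUC; case: (_ == _) => /=; ring.
Qed.

Lemma edge_mx_sqr_le w e (W : R) i : (forall j, w j ^+ 2 <= W) ->
  (edge_mx w e ^+ 2) i i <= W ^+ 2.
Proof.
move=> hW; have W0 : 0 <= W by apply: le_trans (hW i); exact: sqr_ge0.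
apply: (@le_trans _ _ (W ^+ 2 * incidence e i)); last first.
  by have /andP[_ h] := incidence_itv e i; rewrite ler_piMr // sqr_ge0.
rewrite edge_mx_sqr_diag mulr_sumr; apply: ler_sum => j _.
by rewrite ler_wpM2r ?ler0n // [leRHS]expr2 ler_pM ?sqr_ge0.
Qed.

Lemma edge_mx_var_le w E (W : R) i : (forall j, w j ^+ 2 <= W) ->
  \sum_(e in E) (edge_mx w e ^+ 2) i i <= w i ^+ 2 * (degree E i)%:R * W.
Proof.
move=> hW; rewrite -sum_incidence mulrAC mulr_sumr; apply: ler_sum => e _.
rewrite edge_mx_sqr_diag mulr_sumr; apply: ler_sum => j _.
by rewrite ler_wpM2r ?ler0n // ler_wpM2l ?sqr_ge0.
Qed.

Lemma centered_sum_edge_mx w (p : R) E F i j : F \subset E ->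
  centered_sum R _ E p n (edge_mx w) F i j =
  w i * w j * (([set i; j]%SET \in F)%:R - p * ([set i; j]%SET \in E)%:R).
Proof.
move=> FE; rewrite /centered_sum summxE.
transitivity (w i * w j *
    \sum_(e in E) ((e \in F)%:R - p) * ([set i; j]%SET == e)%:R).
  by rewrite mulr_sumr; apply: eq_bigr => e _; rewrite !mxE; ring.
rewrite sum_edge_indicator; congr (_ * _).
have [gE|gE] := boolP (_ \in E); first by rewrite !mulr1.
by rewrite (contraNF (fintype.subsetP FE _) gE) !mulr0 subrr.
Qed.

(** The contribution of [e] to the weighted degrees, placed on a diagonal so that degree deviations
    fall under the same matrix tail bound. *)
Definition degree_mx (c : 'I_n -> R) e : 'M[R]_n :=
  diag_mx (\row_i (c i * incidence e i)).

Lemma degree_mx_sym c e : (degree_mx c e)^T = degree_mx c e.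
Proof. exact: tr_diag_mx. Qed.

Lemma degree_mx_sqr c e i j :
  (degree_mx c e ^+ 2) i j = ((c i * incidence e i) ^+ 2) *+ (i == j).
Proof.
rewrite expr2 -mulmxE mul_diag_mx !mxE; case: eqVneq => [->|_].
  by rewrite !mulr1n expr2.
by rewrite !mulr0n mulr0.
Qed.

Lemma degree_mx_sqr_le c e i :
  (degree_mx c e ^+ 2) i i <= c i ^+ 2 * incidence e i.
Proof.
rewrite degree_mx_sqr eqxx mulr1n exprMn ler_wpM2l ?sqr_ge0 //.
by have /andP[? ?] := incidence_itv e i; rewrite expr2 ler_piMr.
Qed.

Lemma centered_sum_degree_mx c (p : R) E F : F \subset E ->
  centered_sum R _ E p n (degree_mx c) F =
  diag_mx (\row_i (c i * ((degree F i)%:R - p * (degree E i)%:R))).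
Proof.
move=> FE; apply/matrixP => i j; rewrite /centered_sum summxE !mxE.
have [ij|ij] := eqVneq i j; last first.
  by rewrite mulr0n big1 // => e _; rewrite !mxE (negbTE ij) mulr0n mulr0.
rewrite mulr1n -!sum_incidence.
have -> : \sum_(e in F) incidence e i = \sum_(e in E) (e \in F)%:R * incidence e i.
  rewrite big_mkcond [RHS]big_mkcond; apply: eq_bigr => e _.
  have [eF|eF] := boolP (e \in F); first by rewrite (fintype.subsetP FE) // mul1r.
  by rewrite mul0r if_same.
rewrite mulr_sumr -sumrB mulr_sumr; apply: eq_bigr => e _.
by rewrite !mxE ij eqxx mulr1n; ring.
Qed.

End EdgeMatrices.

(** * Perturbation of the Laplacian *)

Section LaplacianPerturbation.
Variables (R : realType) (n : nat).
Implicit Types (E F : {set {set 'I_n}}).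

Notation normalized_adjacency F :=
  (inv_sqrt_degree R F *m adjacency R F *m inv_sqrt_degree R F).

Lemma normalized_adjacencyE F i j : (forall i, (0 < degree F i)%N) ->
  (normalized_adjacency F) i j =
  ([set i; j]%SET \in F)%:R /
    (Num.sqrt (degree F i)%:R * Num.sqrt (degree F j)%:R).
Proof.
move=> h; rewrite mul_mx_diag mxE mul_diag_mx !mxE !gtn_eqF //.
by rewrite invfM; ring.
Qed.

(** Cauchy-Schwarz in row [i] with factors [a i j / sqrt (d i)] and [a i j * v j / sqrt (d j)]: the
    squares of the first sum to [1], and summing those of the second over [i] cancels [d j]. *)
Lemma op_le_normalized_adjacency F : (forall i, (0 < degree F i)%N) ->
  op_le R n (normalized_adjacency F) 1.
Proof.
move=> hF v; rewrite mul1r; apply: norm2_le; first exact: norm2_ge0.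
rewrite sqr_norm2.
have dp i : 0 < (degree F i)%:R :> R by rewrite ltr0n.
pose a i j : R := ([set i; j]%SET \in F)%:R.
pose d i : R := (degree F i)%:R.
have d0 i : 0 <= d i by exact: ltW (dp i).
apply: (@le_trans _ _ (\sum_i \sum_j a i j * (v j ord0 ^+ 2 / d j))).
  apply: ler_sum => i _; rewrite mxE.
  have -> : \sum_j (normalized_adjacency F) i j * v j ord0 =
     \sum_j (a i j / Num.sqrt (d i)) * (a i j * v j ord0 / Num.sqrt (d j)).
    apply: eq_bigr => j _; rewrite normalized_adjacencyE // -/(a i j) /a.
    by case: (_ \in F); rewrite ?mul0r // !mul1r invfM; ring.
  apply: le_trans (sum_mul_sqr_le _ _ _ _) _.
  have -> : \sum_j (a i j / Num.sqrt (d i)) ^+ 2 = 1.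
    have -> : 1 = (\sum_j a i j) / d i by rewrite -degreeE mulfV // gt_eqF ?dp.
    rewrite mulr_suml; apply: eq_bigr => j _.
    rewrite exprMn exprVn sqr_sqrtr ?d0 // /a.
    by case: (_ \in F); rewrite ?expr1n ?expr0n.
  rewrite mul1r; apply: ler_sum => j _.
  rewrite !exprMn exprVn sqr_sqrtr ?d0 // mulrA /a.
  by case: (_ \in F); rewrite ?expr1n ?expr0n.
rewrite exchange_big; apply: ler_sum => j _ /=.
rewrite -mulr_suml; have -> : \sum_i a i j = d j.
  by rewrite /d degreeE; apply: eq_bigr => i _; rewrite /a finset.setUC.
by rewrite mulrCA mulfV ?mulr1 // gt_eqF ?dp.
Qed.

Lemma norm_sqrt_sub1_le (x : R) : 0 <= x -> `|Num.sqrt x - 1| <= `|x - 1|.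
Proof.
move=> x0; have s0 := sqrtr_ge0 x.
have -> : x - 1 = (Num.sqrt x - 1) * (Num.sqrt x + 1).
  by rewrite -subr_sqr sqr_sqrtr // expr1n.
by rewrite normrM ler_peMr // ger0_norm; lra.
Qed.

(** The term [t] bounds the centred sum, and [t * (2 + t) = t * (1 + t) + t] bounds
    [K1 *m N *m K + N *m K1], the cost of replacing expected degrees by actual ones. *)
Lemma laplacian_perturbation E F (p t : R) : F \subset E -> 0 < p ->
  (forall i, (0 < degree E i)%N) -> 0 <= t -> t < 1 ->
  op_le R n (centered_sum R _ E p n
    (edge_mx R n (fun i => (Num.sqrt (p * (degree E i)%:R))^-1)) F) t ->
  (forall i, `|(degree F i)%:R / (p * (degree E i)%:R) - 1| <= t) ->
  op_le R n (laplacian R F - laplacian R E) (t + t * (2 + t)).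
Proof.
move=> FE p0 hE t0 t1 hX hdeg.
have muE i : 0 < p * (degree E i)%:R by rewrite mulr_gt0 ?ltr0n.
(* A vertex of degree [0] in [F] would have relative degree error [1], against [t < 1]. *)
have hF i : (0 < degree F i)%N.
  rewrite lt0n; apply/negP => /eqP d0; have := hdeg i.
  by rewrite d0 mul0r sub0r normrN1; lra.
pose x i := (degree F i)%:R / (p * (degree E i)%:R).
have x0 i : 0 <= x i by rewrite divr_ge0 ?ler0n ?ltW.
pose k i := Num.sqrt (x i).
pose K := diag_mx (\row_i k i); pose K1 := diag_mx (\row_i (k i - 1)).
set X := centered_sum _ _ _ _ _ _ _ in hX.
set N := normalized_adjacency F.
have -> : laplacian R F - laplacian R E = - X + (K1 *m N *m K + N *m K1).
  (* In [X] the factor [p] of the mean cancels against the expected degrees, leaving the normalised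
     adjacency matrix of [E]. *)
  have XE i j : X i j = N i j * (k i * k j) - normalized_adjacency E i j.
    rewrite /X centered_sum_edge_mx // /N !normalized_adjacencyE //.
    have p0' := ltW p0; have mu0 i' := ltW (muE i').
    rewrite /k /x !(sqrtrM _ (ler0n R _)) !(sqrtrV (mu0 _)) !(sqrtrM _ p0').
    have sp q : (0 < q)%N -> Num.sqrt q%:R != 0 :> R.
      by move=> q0; rewrite gt_eqF // sqrtr_gt0 ltr0n.
    have p2 : Num.sqrt p ^+ 2 = p by rewrite sqr_sqrtr.
    have pN0 : Num.sqrt p != 0 by rewrite gt_eqF // sqrtr_gt0.
    rewrite -[p in p * _%:R]p2.
    by field; rewrite pN0 !sp.
  apply/matrixP => i j; rewrite /laplacian -/N.
  have e (M M' : 'M[R]_n) : (1%:M - M - (1%:M - M')) i j = M' i j - M i j.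
    by rewrite !mxE; ring.
  have e' (M M' M'' : 'M[R]_n) : (- M + (M' + M'')) i j = - M i j + (M' i j + M'' i j).
    by rewrite !mxE.
  have d1 (M : 'M[R]_n) : (K1 *m M *m K) i j = (k i - 1) * M i j * k j.
    by rewrite mul_mx_diag mxE mul_diag_mx !mxE.
  have d2 (M : 'M[R]_n) : (M *m K1) i j = M i j * (k j - 1).
    by rewrite mul_mx_diag !mxE.
  by rewrite e e' XE d1 d2; ring.
apply: op_leD; first exact: op_leN.
have kt i : `|k i - 1| <= t.
  by apply: le_trans (hdeg i); apply: norm_sqrt_sub1_le.
have hK1 : op_le R n K1 t by apply: op_le_diag.
have hK : op_le R n K (1 + t).
  apply: op_le_diag => [|i]; first by lra.
  have -> : k i = 1 + (k i - 1) by ring.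
  by apply: le_trans (ler_normD _ _) _; rewrite normr1 lerD2l.
have hN : op_le R n N 1 by exact: op_le_normalized_adjacency.
have -> : t * (2 + t) = t * 1 * (1 + t) + 1 * t by ring.
apply: op_leD; last by apply: op_leM.
by apply: op_leM => //; [rewrite mulr1|apply: op_leM].
Qed.

End LaplacianPerturbation.

(** * Percolation *)

Section Percolation.
Variables (R : realType) (n : nat).
Implicit Types (E F : {set {set 'I_n}}).

(** A union bound over two bad events; a single event is handled by taking [predT] for the other. *)
Lemma percolation_prob_ge E (p : R) (Q Q1 Q2 : pred {set {set 'I_n}}) :
  0 < p < 1 -> (forall F, F \subset E -> Q1 F -> Q2 F -> Q F) ->
  1 - expect R _ E p (fun F => (~~ Q1 F)%:R) -
      expect R _ E p (fun F => (~~ Q2 F)%:R) <= percolation_prob E p Q.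
Proof.
move=> p01 hQ; rewrite /percolation_prob big_mkcondr.
rewrite -[X in X - _ - _](expect_cst R _ E p 1) /expect -!sumrB.
apply: ler_sum => F FE; rewrite -!mulrBr -/(bernoulli_weight R _ E p F).
have w0 := bernoulli_weight_ge0 R _ E p p01 F.
set a : R := (~~ Q1 F)%:R; set b : R := (~~ Q2 F)%:R.
have a0 : 0 <= a by rewrite ler0n.
have b0 : 0 <= b by rewrite ler0n.
have [QF|QF] := boolP (Q F); first by rewrite ler_piMr //; lra.
rewrite mulr_ge0_le0 //; suff : 1 <= a + b by lra.
rewrite -natrD ler1n addn_gt0 !lt0b -negb_and.
by apply: contra QF => /andP[]; exact: hQ.
Qed.

(** The square of [4 * Num.sqrt (s * L)] is the threshold [16 * s * L] of [matrix_tail_bound], and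
    failure of the operator bound supplies its vector. *)
Lemma centered_sum_op_tail E (p : R) (B : {set 'I_n} -> 'M[R]_n) (s beta L : R) :
  0 < p < 1 -> (forall e, (B e)^T = B e) ->
  (forall e i j, i != j -> (B e ^+ 2) i j = 0) -> 0 < s ->
  (forall i, p * (\sum_(e in E) (B e ^+ 2) i i) <= s) ->
  (forall e i, e \in E -> (B e ^+ 2) i i <= beta) ->
  1 <= L -> 8 * L * beta <= s ->
  expect R _ E p (fun F =>
    (~~ `[< op_le R n (centered_sum R _ E p n B F) (4 * Num.sqrt (s * L)) >])%:R)
  <= n%:R * expR (- L).
Proof.
move=> p01 symB diagB s0 hvar hsqr L1 hL.
have sL0 : 0 <= s * L by rewrite mulr_ge0 ?ltW //; lra.
apply: (matrix_tail_bound R _ E p p01 n B symB diagB s beta s0 hvar hsqr) => //.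
move=> F /asboolPn hF.
have [|v hv] := not_op_le R n _ (4 * Num.sqrt (s * L)) _ hF.
  by rewrite mulr_ge0 ?sqrtr_ge0.
exists v; move: hv; rewrite exprMn sqr_sqrtr //.
by congr (_ < _); congr (_ * _); ring.
Qed.

Lemma min_degree_le E i : (min_degree E <= degree E i)%N.
Proof.
rewrite /min_degree; have := mem_index_enum i.
elim: (index_enum _) => // a l IH; rewrite in_cons big_cons geq_min.
by case/orP => [/eqP <-|/IH ->]; rewrite ?leqnn ?orbT.
Qed.

(** The tail bound with unit weights: [s] is [p] times the maximum degree and [beta = 1]. *)
Lemma adjacency_concentration E (p L : R) : (0 < n)%N -> 0 < p < 1 -> 1 <= L ->
  8 * L <= p * (max_degree E)%:R ->
  1 - n%:R * expR (- L) <= percolation_prob E p (fun F =>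
    spectral_norm (adjacency R F - p *: adjacency R E)
      <= 4 * Num.sqrt (p * (max_degree E)%:R * L)).
Proof.
move=> n0 p01 L1 hL; have /andP[p0 p1] := p01.
pose B := edge_mx R n (fun=> 1).
pose Q1 F := `[< op_le R n (centered_sum R _ E p n B F)
                   (4 * Num.sqrt (p * (max_degree E)%:R * L)) >].
apply: le_trans (percolation_prob_ge E p _ Q1 predT p01 _); last first.
  move=> F FE /asboolP h _; apply: spectral_norm_le => //.
  suff -> : adjacency R F - p *: adjacency R E = centered_sum R _ E p n B F by [].
  by apply/matrixP => i j; rewrite centered_sum_edge_mx // !mxE !mul1r.
have -> : expect R _ E p (fun F => (~~ predT F)%:R) = 0 by rewrite /= expect_cst.
rewrite subr0 lerD2l lerN2; apply: (@centered_sum_op_tail _ _ _ _ 1) => //.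
- by move=> e; exact: edge_mx_sym.
- by move=> e i j; exact: edge_mx_sqr_offdiag.
- by lra.
- move=> i; rewrite ler_wpM2l ?(ltW p0) //.
  apply: le_trans (edge_mx_var_le R n _ E 1 i _) _; first by move=> j; rewrite expr1n.
  by rewrite expr1n mul1r mulr1 ler_nat; exact: leq_bigmax.
- move=> e i _; apply: le_trans (edge_mx_sqr_le R n _ e 1 i _) _.
    by move=> j; rewrite expr1n.
  by rewrite expr1n.
- by lra.
Qed.

(** Both the weighted edge matrices and the degree matrices satisfy the tail hypotheses with
    [s = D^-1] and [beta = D^-1 ^+ 2], as their weights cancel an expected degree in the variance.
    The two bad events account for the factor [2]. *)
Lemma laplacian_concentration E (p L : R) : (0 < n)%N -> 0 < p < 1 -> 1 <= L ->
  64 * L <= p * (min_degree E)%:R ->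
  1 - 2 * (n%:R * expR (- L)) <= percolation_prob E p (fun F =>
    spectral_norm (laplacian R F - laplacian R E)
      <= 14 * Num.sqrt (L / (p * (min_degree E)%:R))).
Proof.
move=> n0 p01 L1 hL; have /andP[p0 p1] := p01.
set D := p * (min_degree E)%:R in hL *; have D0 : 0 < D by lra.
have mu i : D <= p * (degree E i)%:R.
  by rewrite /D ler_pM2l // ler_nat min_degree_le.
have mu0 i : 0 < p * (degree E i)%:R by exact: lt_le_trans (mu i).
have hE i : (0 < degree E i)%N.
  by have := mu0 i; rewrite pmulr_rgt0 // ltr0n.
pose w i := (Num.sqrt (p * (degree E i)%:R))^-1.
have w2 i : w i ^+ 2 = (p * (degree E i)%:R)^-1.
  by rewrite /w exprVn sqr_sqrtr // ltW.
have w2D i : w i ^+ 2 <= D^-1 by rewrite w2 lef_pV2 ?posrE.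
pose c i := (p * (degree E i)%:R)^-1.
pose t := 4 * Num.sqrt (D^-1 * L).
pose Q1 F := `[< op_le R n (centered_sum R _ E p n (edge_mx R n w) F) t >].
pose Q2 F := `[< op_le R n (centered_sum R _ E p n (degree_mx R n c) F) t >].
have r0 := sqrtr_ge0 (D^-1 * L).
(* The constant [64] gives [t <= 1 / 2], hence [t + t * (2 + t) <= 7 / 2 * t], and [7 / 2] times the
   [4] in [t] is [14]. *)
have r8 : Num.sqrt (D^-1 * L) <= 1 / 8.
  rewrite -(ler_pXn2r (_ : 0 < 2)%N) ?nnegrE //.
  rewrite sqr_sqrtr; last by rewrite mulr_ge0 ?invr_ge0 //; lra.
  by rewrite mulrC ler_pdivrMr //; lra.
have DL : 8 * L * (D^-1 ^+ 2) <= D^-1.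
  by rewrite expr2 mulrA ler_piMl ?invr_ge0 ?(ltW D0) // ler_pdivrMr //; lra.
apply: le_trans (percolation_prob_ge E p _ Q1 Q2 p01 _); last first.
  move=> F FE /asboolP h1 /asboolP h2; apply: spectral_norm_le => //.
  move=> v; apply: le_trans (laplacian_perturbation R n E F p t FE p0 hE _ _ h1 _ v) _.
  - by rewrite /t; lra.
  - by rewrite /t; lra.
  - move=> i; move: h2; rewrite centered_sum_degree_mx //.
    move=> /op_le_diag_entry => /(_ i).
    by rewrite mulrBr /c [_^-1 * (p * _)]mulVf ?gt_eqF // mulrC.
  rewrite ler_wpM2r ?norm2_ge0 // [L / D]mulrC /t.
  set r := Num.sqrt _ in r0 r8 *.
  have : r * r <= 1 / 8 * r by rewrite ler_wpM2r.
  by lra.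
have b1 : expect R _ E p (fun F => (~~ Q1 F)%:R) <= n%:R * expR (- L).
  apply: (@centered_sum_op_tail _ _ _ _ (D^-1 ^+ 2)) => //.
  - by move=> e; exact: edge_mx_sym.
  - by move=> e i j; exact: edge_mx_sqr_offdiag.
  - by rewrite invr_gt0.
  - move=> i; apply: le_trans (ler_wpM2l (ltW p0) (edge_mx_var_le R n _ E _ i w2D)) _.
    by rewrite w2 mulrA mulrCA mulVf ?mulr1 ?mul1r // gt_eqF.
  - by move=> e i _; exact: edge_mx_sqr_le.
have b2 : expect R _ E p (fun F => (~~ Q2 F)%:R) <= n%:R * expR (- L).
  have c2D i : c i ^+ 2 <= D^-1 ^+ 2.
    by apply: lerXn2r; rewrite ?nnegrE ?invr_ge0 ?lef_pV2 ?posrE // ltW.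
  apply: (@centered_sum_op_tail _ _ _ _ (D^-1 ^+ 2)) => //.
  - by move=> e; exact: degree_mx_sym.
  - by move=> e i j ij; rewrite degree_mx_sqr (negbTE ij).
  - by rewrite invr_gt0.
  - move=> i; apply: (@le_trans _ _ (p * (c i ^+ 2 * (degree E i)%:R))).
      rewrite ler_wpM2l ?(ltW p0) // -sum_incidence mulr_sumr.
      by apply: ler_sum => e _; exact: degree_mx_sqr_le.
    have -> : p * (c i ^+ 2 * (degree E i)%:R) = c i.
      by rewrite mulrCA expr2 -mulrA /c mulVf ?mulr1 // gt_eqF.
    by rewrite lef_pV2 ?posrE.
  - move=> e i _; apply: le_trans (degree_mx_sqr_le _ _ _ _ _) _.
    apply: le_trans (c2D i); have /andP[_ h] := incidence_itv R n e i.
    by rewrite ler_piMr // sqr_ge0.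
by lra.
Qed.

End Percolation.

Theorem theorem5 (R : realType) (c : R) (hc : 0 < c) :
  exists2 C : R, 0 < C &
  forall (n : nat) (G : {set {set 'I_n}}) (p : R),
    (0 < n)%N -> is_graph G -> 0 < p < 1 ->
    C * ln n%:R <= p * (min_degree G)%:R ->
    forall delta : R, n%:R `^ (- c) <= delta <= 1 / 2 ->
      1 - delta <=
        percolation_prob G p (fun Gp =>
          spectral_norm (adjacency R Gp - p *: adjacency R G)
            <= 4 * Num.sqrt (p * (max_degree G)%:R * ln (n%:R / delta)))
      /\
      1 - delta <=
        percolation_prob G p (fun Gp =>
          spectral_norm (laplacian R Gp - laplacian R G)
            <= 14 * Num.sqrt (ln (4 * n%:R / delta) / (p * (min_degree G)%:R))).
Proof.
(* The [64] is that of [laplacian_concentration], and [ln (4 * n / delta) <= (3 + c) * ln n] because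
   [ln 4 <= 2 * ln n] and [- ln delta <= c * ln n]. *)
exists (64 * (3 + c)); first by lra.
move=> n G p n0 _ p01 hd delta /andP[dl du].
(* For [n = 1] the lower bound on [delta] is [1], so no [delta] is admissible. *)
have n1 : (1 < n)%N.
  rewrite ltn_neqAle n0 andbT eq_sym; apply/eqP => n1.
  by move: dl; rewrite n1 powR1; lra.
have np : 0 < n%:R :> R by rewrite ltr0n.
have d0 : 0 < delta by apply: lt_le_trans dl; exact: powR_gt0.
have n2 : 2 <= n%:R :> R by rewrite ler_nat.
have lnn0 : 0 <= ln n%:R :> R by rewrite ln_ge0 //; lra.
have lnd : - ln delta <= c * ln n%:R.
  have : ln (n%:R `^ (- c)) <= ln delta by rewrite ler_ln ?posrE ?powR_gt0.
  by rewrite ln_powR; lra.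
have ln2 : ln 2 <= ln n%:R :> R by rewrite ler_ln ?posrE.
have lnE x : 0 < x -> ln (x / delta) = ln x - ln delta.
  by move=> x0; rewrite ln_div ?posrE.
have ln4 : ln 4 = 2 * ln 2 :> R.
  have -> : 4 = 2 ^+ 2 :> R by ring.
  by rewrite lnXn // mulr_natl.
have ln4n : ln (4 * n%:R) = ln 4 + ln n%:R :> R by rewrite lnM ?posrE.
have nd4 : 4 <= n%:R / delta by rewrite ler_pdivlMr //; lra.
have L1 : 1 <= ln (n%:R / delta).
  rewrite -[leLHS]expRK ler_ln ?posrE ?expR_gt0 ?divr_gt0 //.
  apply: le_trans nd4; apply: le_trans (expR_5div4_le4 R).
  by rewrite ler_expR; lra.
have L12 : ln (n%:R / delta) <= ln (4 * n%:R / delta).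
  rewrite ler_ln ?posrE ?divr_gt0 ?mulr_gt0 //.
  by rewrite ler_pM2r ?invr_gt0 //; lra.
have hL : 64 * ln (4 * n%:R / delta) <= p * (min_degree G)%:R.
  apply: le_trans hd; rewrite lnE ?mulr_gt0 // ln4n ln4.
  by nra.
have dD : p * (min_degree G)%:R <= p * (max_degree G)%:R.
  rewrite ler_pM2l; last by case/andP: p01.
  rewrite ler_nat; apply: leq_trans (min_degree_le n G (Ordinal n0)) _.
  exact: leq_bigmax.
have eL x : 0 < x -> expR (- ln (x / delta)) = delta / x.
  by move=> x0; rewrite expRN lnK ?posrE ?divr_gt0 // invf_div.
split.
  (* Here [L = ln (n / delta)], so the failure bound [n * expR (- L)] equals [delta]. *)
  apply: le_trans (adjacency_concentration R n G p _ n0 p01 L1 _); last by lra.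
  by rewrite eL // mulrCA mulfV ?mulr1 // gt_eqF.
apply: le_trans (laplacian_concentration R n G p _ n0 p01 _ hL); last by lra.
rewrite eL ?mulr_gt0 //.
(* With [L = ln (4 * n / delta)] each of the two bad events is bounded by [delta / 4], in total
   [delta / 2]. *)
have -> : n%:R * (delta / (4 * n%:R)) = delta / 4.
  by field; rewrite gt_eqF.
by lra.
Qed.
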